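(* Assume $cov(\mathcal{M})<\mathfrak{b}$. Then there is a compact space which is not weakly Rothberger and has $\pi$-weight $cov(\mathcal{M})$.
   Context: $cov(\mathcal{M})$ is the least cardinality of a family of meager subsets of the real line covering the real line. $\mathfrak{b}$ is the least cardinality of a subset of $\omega^\omega$ that is unbounded with respect to eventual domination $\le^*$. A $\pi$-base for a space $X$ is a family $\mathcal{P}$ of non-empty open sets such that every non-empty open $U\subset X$ contains some $P\in\mathcal{P}$; the $\pi$-weight of $X$ is the minimum cardinality of a $\pi$-base. $X$ is weakly Rothberger if for every sequence $(\mathcal{U}_n)_{n<\omega}$ of open covers of $X$ one can choose $U_n\in\mathcal{U}_n$ for each $n<\omega$ such that $\bigcup_{n<\omega}U_n$ is dense in $X$. *)

(* Defs.v *)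
From HB Require Import structures.
From mathcomp Require Import all_boot all_order all_algebra.
From mathcomp Require Import all_classical all_reals all_analysis.

Set Implicit Arguments.
Unset Strict Implicit.
Unset Printing Implicit Defensive.

Import Order.TTheory GRing.Theory Num.Theory.
Import numFieldNormedType.Exports.

Local Open Scope classical_set_scope.

(* A cardinal is represented by a set having that cardinality; [card_lt A B]
   is |A| < |B|. *)
Definition card_lt {T U : Type} (A : set T) (B : set U) : Prop :=
  (A #<= B)%card /\ ~ (B #<= A)%card.

(* The least cardinality of a set satisfying [Q], represented by a chosen
   witness; the default [set0] is only reached when no set satisfies [Q], as
   [min_cardP] shows. *)
Definition min_card {T : Type} (Q : set (set T)) : set T :=
  xget set0 [set A | Q A /\ forall B, Q B -> (A #<= B)%card].

Lemma min_cardP {T : Type} (Q : set (set T)) (A0 : set T) : Q A0 ->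
  Q (min_card Q) /\ forall B, Q B -> (min_card Q #<= B)%card.
Proof.
move=> QA0; rewrite /min_card.
suff [A hA] : exists A, Q A /\ forall B, Q B -> (A #<= B)%card.
  by case: xgetP => [B _ //|/(_ A)]; case.
have [Qset0|NQset0] := pselect (Q set0).
  by exists set0; split => // B _; exact: card_ge0.
have Qne A : Q A -> exists x, A x.
  move=> QA; apply: contrapT => h; apply: NQset0.
  by rewrite (_ : set0 = A) //; apply/seteqP; split => x //= Ax; case: h; exists x.
(* Zorn on sets of choice functions that pairwise differ at every member
   of Q *)
pose P (S : set (set T -> T)) :=
  (forall f A, S f -> Q A -> A (f A)) /\
  (forall f g A, S f -> S g -> Q A -> f A = g A -> f = g).
have [S [[Sin Sinj] Smax]] : exists S, P S /\ forall B, S `<` B -> ~ P B.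
  apply: Zorn_bigcup => F FP Ftot; split.
    by move=> f A [X FX Xf] QA; have [h _] := FP _ FX; exact: (h f A).
  move=> f g A [X FX Xf] [Y FY Yg].
  have [XY|YX] := Ftot _ _ FX FY.
    by have [_ h] := FP _ FY; apply: (h f g A) => //; exact: XY.
  by have [_ h] := FP _ FX; apply: (h f g A) => //; exact: YX.
have [A QA Asurj] : exists2 A, Q A & forall x, A x -> exists2 f, S f & f A = x.
  apply: contrapT => hN.
  have new A : exists x, Q A -> A x /\ forall f, S f -> f A <> x.
    have [QA|NQA] := pselect (Q A); last first.
      by have [x _] := Qne _ QA0; exists x.
    apply: contrapT => h; apply: hN; exists A => // x Ax.
    apply: contrapT => h'; apply: h; exists x => _; split=> // f Sf fx.
    by apply: h'; exists f.
  have [g hg] := choice new.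
  apply: (Smax (S `|` [set g])).
    split; first by move=> f Sf; left.
    move=> /(_ g (or_intror erefl)) Sg.
    by have [_ h] := hg _ QA0; exact: (h g Sg).
  split.
    by move=> f A [Sf|->] QA; [exact: (Sin f A)|have [h _] := hg _ QA; exact: h].
  move=> f f' A [Sf|->] [Sf'|->] QA // e.
  - exact: (Sinj f f' A).
  - by have [_ h] := hg _ QA; case: (h _ Sf e).
  - by have [_ h] := hg _ QA; case: (h _ Sf' (esym e)).
exists A; split=> // B QB.
apply: (@card_le_trans _ _ _ S).
  apply: card_le_trans (card_image_le (fun f : set T -> T => f A) S).
  by apply: subset_card_le => x /Asurj[f Sf fx]; exists f.
have inj : {in S &, injective (fun f : set T -> T => f B)}.
  by move=> f g /set_mem Sf /set_mem Sg /=; exact: (Sinj f g B).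
have := inj_card_eq inj => /card_eqPle[_ h].
by apply: card_le_trans h _; apply: subset_card_le => _ [f Sf <-]; exact: (Sin f B).
Qed.

Definition nowhere_dense {X : topologicalType} (A : set X) : Prop :=
  (closure A)° = set0.

Definition meager {X : topologicalType} (A : set X) : Prop :=
  exists F : nat -> set X,
    (forall n, nowhere_dense (F n)) /\ A = \bigcup_n F n.

Definition meager_covering (R : realType) (F : set (set R)) : Prop :=
  (forall A, F A -> meager A) /\ \bigcup_(A in F) A = setT.

Definition cov_meager (R : realType) : set (set R) :=
  min_card [set F | meager_covering F].
Arguments cov_meager R : clear implicits.

Definition eventually_dominated (f g : nat -> nat) : Prop :=
  \forall n \near \oo, (f n <= g n)%N.

Definition unbounded_family (F : set (nat -> nat)) : Prop :=
  ~ exists g, forall f, F f -> eventually_dominated f g.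

Definition bounding_number : set (nat -> nat) :=
  min_card [set F | unbounded_family F].

Definition pi_base (X : topologicalType) (P : set (set X)) : Prop :=
  (forall A, P A -> open A /\ A !=set0) /\
  (forall U, open U -> U !=set0 -> exists2 A, P A & A `<=` U).

Definition pi_weight (X : topologicalType) : set (set X) :=
  min_card [set P | pi_base P].
Arguments pi_weight X : clear implicits.

Definition open_covering (X : topologicalType) (C : set (set X)) : Prop :=
  (forall U, C U -> open U) /\ \bigcup_(U in C) U = setT.

Definition weakly_Rothberger (X : topologicalType) : Prop :=
  forall C : nat -> set (set X), (forall n, open_covering (C n)) ->
  exists U : nat -> set X, (forall n, C n (U n)) /\ dense (\bigcup_n U n).

(* Main.v *)
Require Import Defs.
From HB Require Import structures.
From mathcomp Require Import all_boot all_order all_algebra.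
From mathcomp Require Import all_classical all_reals all_analysis.
From mathcomp Require Import lra zify.
Import Order.TTheory GRing.Theory Num.Theory.
Import numFieldNormedType.Exports.
Local Open Scope classical_set_scope.

(* Let M be a cover of the line by cov(M) many meager sets, and pull it back to
   Cantor space by binary expansion.  A meager set A = U_i F_i yields words t_n
   such that no sequence carrying t_n at position n lies over F_0, ..., F_n.
   Since |M| < b, a single interval partition ([j_k, j_(k+1)))_k is coarse enough
   that, for every A in M and almost all k, the word t_(j_k) of A fits into the
   k-th block.  Placing these words at the beginnings of the blocks gives x_A, and
   a sequence that agrees with x_A on infinitely many blocks does not lie over A.
   As M is a cover, every y thus differs from some x_A on almost all blocks.

   The space is the closure in 2^(omega + M) of the points (x_A, indicator of A),
   which are isolated in it and dense, so its pi-weight is |M|.  The cylinders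
   over the k-th block form an open cover; choosing one of them for every k
   amounts to choosing y, and an isolated point that belongs to infinitely many of
   the chosen cylinders is an x_A agreeing with y on infinitely many blocks. *)

Lemma compact_set_type (T : topologicalType) (A : set T) :
  compact A -> compact [set: A].
Proof.
move=> cA F FF _.
have FA : F (set_val @^-1` A) by apply: filterE => -[z Az]; exact: set_mem Az.
have [p [Ap clp]] := cA (set_val @ F) _ FA.
exists (exist _ p (mem_set Ap)); split => // V W FV [_ [[U oU <-] Up] UW].
have FV' : F (set_val @^-1` (set_val @` V)) by apply: (filterS _ FV) => x Vx; exists x.
have [_ [[x Vx <-] Ux]] := clp _ U FV' (open_nbhs_nbhs (conj oU Up)).
by exists x; split => //; exact: UW.
Qed.

Lemma hausdorff_set_type (T : topologicalType) (A : set T) :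
  hausdorff_space T -> hausdorff_space A.
Proof.
rewrite !open_hausdorff => hT x y xy.
have /hT[[U V] /= [Ux Vy] [oU oV UV]] : val x != val y.
  by rewrite (inj_eq val_inj).
exists (val @^-1` U, val @^-1` V) => /=; first by rewrite !inE in Ux Vy *.
split; [by exists U|by exists V|].
apply/eqP; rewrite -subset0 => z [Uz Vz].
by have : (U `&` V) (val z) by []; rewrite (eqP UV).
Qed.

Lemma pi_weight_discrete_dense (X : topologicalType) (I : Type) (M : set I)
    (q : I -> X) :
  (forall i, M i -> open [set q i]) -> dense (q @` M) ->
  {in M &, injective q} -> (pi_weight X #= M)%card.
Proof.
move=> oq dq qinj.
pose P0 := (fun i => [set q i]) @` M.
have P0b : pi_base P0.
  split=> [_ [i Mi <-]|U oU U0]; first by split; [exact: oq|exists (q i)].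
  have [y [Uy [i Mi iy]]] := dq _ U0 oU; rewrite -iy in Uy.
  by exists [set q i] => [|_ ->]; [exists i|].
have [[pP pPd] pmin] := @min_cardP _ [set P | pi_base P] _ P0b.
apply/card_eqPle; split.
  exact: card_le_trans (pmin _ P0b) (card_image_le _ _).
have inj : {in M &, injective (fun i => [set q i])}.
  move=> i j Mi Mj /= e; apply: qinj => //.
  by have : [set q i] (q i) by []; rewrite e.
have /card_eqPle[_ h] := inj_card_eq inj.
apply: card_le_trans h _; apply: subset_card_le => _ [i Mi <-].
have [V PV Vi] := pPd _ (oq _ Mi) (ex_intro _ (q i) erefl).
suff -> : [set q i] = V by [].
have [_ [v Vv]] := pP _ PV.
by apply/seteqP; split => // _ ->; have <- := Vi _ Vv.
Qed.

(* X is the closure of {(x i, indicator of i) : i in M} in {0,1}^(nat + I): the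
   indicator coordinates make the points of this set isolated. *)
Lemma labelled_compactification (I : choiceType) (M : set I)
    (x : I -> nat -> bool) : M !=set0 ->
  exists (X : topologicalType) (q : I -> X) (d : X -> nat -> bool),
    [/\ compact [set: X] /\ hausdorff_space X,
        (pi_weight X #= M)%card,
        forall n b, open [set z | d z n = b],
        forall i, M i -> open [set q i] &
        forall i, M i -> d (q i) = x i].
Proof.
move=> [i0 Mi0]; pose J := (nat + I)%type.
pose T := prod_topology (fun _ : J => bool).
pose p (i : I) : T :=
  fun j => match j with inl n => x i n | inr k => i == k end.
pose K : set T := closure (p @` M).
have oT (j : J) b : open [set z : T | z j = b].
  rewrite (_ : [set _ | _] = proj j @^-1` [set b]) //.
  by apply: open_comp => [z _|]; [exact: proj_continuous|exact: discrete_open].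
have cT : compact [set: T].
  have := @tychonoff J (fun=> bool) _ (fun=> bool_compact).
  by congr (compact _); rewrite eqEsubset.
have hT : hausdorff_space T.
  by apply: hausdorff_product => ?; exact: discrete_hausdorff.
have cK : compact K.
  by apply: subclosed_compact cT _ => //; exact: closed_closure.
have pK i : M i -> K (p i) by move=> Mi; apply: subset_closure; exists i.
have oK j b : open [set z : K | val z j = b] by exists [set z : T | z j = b].
have p1 i j : p j (inr i) = true -> j = i by move/eqP.
pose q i : K := if pselect (M i) is left Mi then exist _ (p i) (mem_set (pK i Mi))
  else exist _ (p i0) (mem_set (pK i0 Mi0)).
have qE i : M i -> val (q i) = p i.
  by rewrite /q; case: pselect.
have dq : dense (q @` M).
  move=> U [z Uz] [V oV VU]; rewrite -VU in Uz *.
  have [_ [[i Mi <-] Vi]] := set_mem (valP z) _ (open_nbhs_nbhs (conj oV Uz)).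
  exists (q i); split; last by exists i.
  by rewrite /preimage/= -[set_val _]/(val (q i)) qE.
have oq i : M i -> open [set q i].
  move=> Mi; rewrite (_ : [set q i] = [set z : K | val z (inr i) = true]) //.
  apply/seteqP; split=> [_ ->|z zi] /=; first by rewrite qE // /p eqxx.
  apply: contrapT => zq.
  have [] := dq ([set w | val w (inr i) = true] `&` ~` [set q i]).
  - by exists z.
  - apply: openI => //; apply: closed_openC.
    apply: accessible_closed_set1; apply: hausdorff_accessible.
    exact: hausdorff_set_type.
  - move=> w [[wi wq] [j Mj jw]]; apply: wq.
    by move: wi; rewrite -jw /= qE // => /p1 ->.
exists K, q, (fun z n => val z (inl n)); split=> //.
- split; [exact: compact_set_type|exact: hausdorff_set_type].
- apply: pi_weight_discrete_dense dq _ => // i j /set_mem Mi /set_mem Mj e.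
  have := qE i Mi; rewrite e qE // => /(congr1 (@^~ (inr i))) /=.
  by rewrite eqxx => /eqP ->.
- by move=> i Mi; rewrite qE.
Qed.

Definition dyadic (R : realType) (y : nat -> bool) (n : nat) : R :=
  (\sum_(i < n) (y i)%:R / 2 ^+ i.+1)%R.

Section Dyadic.
Variable R : realType.
Local Open Scope ring_scope.
Implicit Types (y z : nat -> bool) (r : R).
Local Notation dyadic := (dyadic R).

Lemma dyadicS y n : dyadic y n.+1 = dyadic y n + (y n)%:R / 2 ^+ n.+1.
Proof. by rewrite /dyadic big_ord_recr. Qed.

Lemma eq_dyadic y z n : (forall i, (i < n)%N -> y i = z i) ->
  dyadic y n = dyadic z n.
Proof. by move=> yz; apply: eq_bigr => i _; rewrite yz. Qed.

Lemma half_exp n : (2 ^- n.+1 : R) = 2 ^- n / 2.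
Proof. by rewrite exprSr invfM. Qed.

Lemma dyadic_nested y m n : (m <= n)%N ->
  dyadic y m <= dyadic y n /\ dyadic y n + 2 ^- n <= dyadic y m + 2 ^- m.
Proof.
move=> /subnKC <-; elim: (n - m)%N => [|k [IH1 IH2]]; first by rewrite addn0.
have p : (0 : R) < 2 ^- (m + k) by rewrite invr_gt0 exprn_gt0.
rewrite addnS dyadicS half_exp.
by case: (y _) => /=; rewrite ?mul0r ?mul1r ?half_exp; lra.
Qed.

Lemma dyadic_limit y :
  exists r, forall n, dyadic y n <= r <= dyadic y n + 2 ^- n.
Proof.
have ub m n : dyadic y m <= dyadic y n + 2 ^- n.
  have [mn|nm] := leqP m n.
    have [h _] := dyadic_nested y m n mn.
    by rewrite (le_trans h)// lerDl invr_ge0 exprn_ge0.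
  have [_ h] := dyadic_nested y n m (ltnW nm).
  by apply: le_trans h; rewrite lerDl invr_ge0 exprn_ge0.
have S0 : range (dyadic y) !=set0 by exists (dyadic y 0); exists 0%N.
exists (sup (range (dyadic y))) => n; apply/andP; split.
  apply: ub_le_sup; last by exists n.
  by exists (dyadic y 0 + 2 ^- 0) => _ [m _ <-].
by apply: ge_sup => // _ [m _ <-].
Qed.

Lemma dyadic_refine y n r k : dyadic y n <= r <= dyadic y n + 2 ^- n ->
  exists2 z, (forall i, (i < n)%N -> z i = y i) &
    dyadic z (n + k) <= r <= dyadic z (n + k) + 2 ^- (n + k).
Proof.
move=> ry; elim: k => [|k [z zy /andP[rz1 rz2]]].
  by exists y; rewrite ?addn0.
pose b := dyadic z (n + k) + 2 ^- (n + k).+1 <= r.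
exists (fun i => if i == (n + k)%N then b else z i).
  by move=> i lin; case: eqP => [?|_]; [lia|exact: zy].
rewrite addnS dyadicS eqxx (eq_dyadic _ z) => [|i ik]; last first.
  by rewrite ltn_eqF.
move: rz2.
have -> : (2 ^- (n + k) : R) = 2 ^- (n + k).+1 + 2 ^- (n + k).+1.
  by rewrite half_exp -splitr.
rewrite {}/b; case: (leP (dyadic z _ + 2 ^- (n + k).+1) r) => /=;
  by rewrite ?mul1r ?mul0r; lra.
Qed.

End Dyadic.

Definition avoidable (T : Type) (f : (nat -> bool) -> T) (N : set T) : Prop :=
  forall u : seq bool, exists v : seq bool, forall y : nat -> bool,
    mkseq y (size (u ++ v)) = u ++ v -> ~ N (f y).

Lemma nowhere_dense_avoidance (R : realType) :
  exists f : (nat -> bool) -> R,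
    forall N : set R, nowhere_dense N -> avoidable R f N.
Proof.
have [f fP] := choice (dyadic_limit R).
exists f => N Nnd u.
pose y0 := nth false u; pose n := size u; pose a := dyadic R y0 n.
have p : (0 < 2 ^- n :> R)%R by rewrite invr_gt0 exprn_gt0.
have [r /andP[r1 r2] Nr] : exists2 r, (a < r < a + 2 ^- n)%R & ~ closure N r.
  apply: contrapT => h.
  have : (closure N)° (a + 2 ^- n / 2)%R.
    apply: (@filterS _ _ _ `]a, (a + 2 ^- n)%R[%classic).
      by move=> r; rewrite /= in_itv/= => ar; apply: contrapT => Nr; apply: h; exists r.
    by apply: near_in_itvoo; rewrite in_itv/=; apply/andP; split; lra.
  by rewrite Nnd.
have /nbhs_ballP[e /= e0 eN] : nbhs r (~` closure N).
  by apply: open_nbhs_nbhs; split => //; exact/closed_openC/closed_closure.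
have [k ke] : exists k, (2 ^- (n + k) < e)%R.
  have [m _ /(_ (n + m)%N) /=] := near_infty_natSinv_expn_lt (PosNum e0).
  by rewrite mul1r => h; exists m; apply: h; exact: leq_addl.
have [z zy /andP[z1 z2]] := dyadic_refine R y0 n r k
  (introT andP (conj (ltW r1) (ltW r2))).
exists (mkseq (fun i => z (n + i)) k) => y yuv.
have yz i : (i < n + k)%N -> y i = z i.
  move=> ik; have := congr1 (nth false ^~ i) yuv.
  rewrite nth_mkseq ?size_cat ?size_mkseq // => ->.
  rewrite nth_cat; case: ltnP => iu; first by rewrite zy.
  by rewrite nth_mkseq -/n ?subnKC //; lia.
have /andP[] := fP y (n + k); rewrite (eq_dyadic R y z) // => y1 y2 Ny.
apply: (eN (f y)); last exact: subset_closure.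
by rewrite /ball/= ltr_norml; apply/andP; split; lra.
Qed.

Section Avoidance.
Variables (T : Type) (f : (nat -> bool) -> T).

Lemma avoidable_word (N : nat -> set T) (l : seq (seq bool * nat)) :
  (forall i, avoidable T f (N i)) ->
  exists v : seq bool, forall s i, (s, i) \in l -> forall y : nat -> bool,
    mkseq y (size (s ++ v)) = s ++ v -> ~ N i (f y).
Proof.
move=> Nav; elim: l => [|[s0 i0] l [v vP]]; first by exists [::].
have [w wP] := Nav i0 (s0 ++ v).
exists (v ++ w) => s i; rewrite inE catA => /orP[/eqP[-> ->]|sl] y yE.
  exact: wP.
apply: (vP s i sl); move/(congr1 (take (size (s ++ v)))): yE.
rewrite take_size_cat // /mkseq -map_take take_iota (minn_idPl _) //.
by rewrite [in leqRHS]size_cat leq_addr.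
Qed.

Lemma avoidable_block (N : nat -> set T) : (forall i, avoidable T f (N i)) ->
  exists t : nat -> seq bool, forall n i (y : nat -> bool), (i <= n)%N ->
    (forall k, (k < size (t n))%N -> y (n + k)%N = nth false (t n) k) ->
    ~ N i (f y).
Proof.
move=> Nav.
have /choice[t tP] n : exists v : seq bool, forall i (y : nat -> bool),
    (i <= n)%N ->
    (forall k, (k < size v)%N -> y (n + k)%N = nth false v k) -> ~ N i (f y).
  have [v vP] := avoidable_word N
    [seq (val s, i) | s <- enum {:n.-tuple bool}, i <- iota 0 n.+1] Nav.
  exists v => i y lin yv; apply: (vP (mkseq y n) i).
    apply/allpairsP; exists (Tuple (introT eqP (size_mkseq y n)), i).
    by split; rewrite /= ?mem_enum ?(mem_iota 0 n.+1).
  apply: (@eq_from_nth _ false); first by rewrite size_mkseq.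
  rewrite size_mkseq => k ks; rewrite nth_mkseq // nth_cat size_mkseq.
  case: ltnP => kn; first by rewrite nth_mkseq.
  rewrite size_cat size_mkseq in ks.
  by rewrite -yv ?subnKC // ltn_subLR.
by exists t => n; exact: tP.
Qed.

End Avoidance.

Lemma dominated_family (I : Type) (M : set I) (e : I -> nat -> nat) :
  ~ (bounding_number #<= M)%card ->
  exists h : nat -> nat, forall i, M i -> \forall n \near \oo, (e i n <= h n)%N.
Proof.
move=> Mb; apply: contrapT => he; apply: Mb.
have ub : unbounded_family (e @` M).
  by move=> [g gP]; apply: he; exists g => i Mi; apply: gP; exists i.
have [_ /(_ _ ub) h] := @min_cardP _ [set F | unbounded_family F] _ ub.
exact: card_le_trans h (card_image_le _ _).
Qed.

Lemma block_index (j : nat -> nat) : (forall k, (j k < j k.+1)%N) ->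
  exists b : nat -> nat, forall i k, (j k <= i < j k.+1)%N -> k = b i.
Proof.
move=> jlt; have jmono : {homo j : k l / (k <= l)%N}.
  by apply: homo_leq leqnn leq_trans _ => k; exact: ltnW.
have /choice[b bP] i : exists b, forall k, (j k <= i < j k.+1)%N -> k = b.
  have [[k ki]|nk] := pselect (exists k, j k <= i < j k.+1)%N; last first.
    by exists 0%N => k ki; case: nk; exists k.
  by exists k => k' ki'; have := jmono k.+1 k'; have := jmono k'.+1 k; lia.
by exists b.
Qed.

Lemma evading_blocks (R : realType) (M : set (set R)) :
  meager_covering M -> ~ (bounding_number #<= M)%card ->
  exists (j : nat -> nat) (x : set R -> nat -> bool),
    (forall k, (j k < j k.+1)%N) /\
    forall y : nat -> bool, exists2 A, M A & \forall k \near \oo,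
      exists2 i, (j k <= i < j k.+1)%N & y i <> x A i.
Proof.
move=> [Mm Mcov] Mb.
have [f fP] := nowhere_dense_avoidance R.
have /choice[t tP] A : exists t : nat -> seq bool, M A ->
    forall y : nat -> bool,
      (forall m, exists2 n, (m <= n)%N & forall k, (k < size (t n))%N ->
         y (n + k)%N = nth false (t n) k) -> ~ A (f y).
  have [MA|] := pselect (M A); last by exists (fun=> [::]).
  have [F [Fnd ->]] := Mm A MA.
  have [t tP] := avoidable_block R f F (fun i => fP _ (Fnd i)).
  exists t => _ y yt [i _ Fi].
  by have [n lin yn] := yt i; exact: (tP n i y lin yn Fi).
have [h hP] := dominated_family _ M (fun A n => n + size (t A n))%N Mb.
pose j := fix j k := if k is k'.+1 then maxn (h (j k')) (j k').+1 else 0%N.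
have jlt k : (j k < j k.+1)%N by rewrite leq_maxr.
have jge k : (k <= j k)%N.
  by elim: k => // k IH; exact: leq_ltn_trans IH (jlt k).
have jS k : (h (j k) <= j k.+1)%N by rewrite leq_maxl.
clearbody j; have [b bP] := block_index j jlt.
exists j, (fun A i => nth false (t A (j (b i))) (i - j (b i))); split => // y.
have [A MA Ay] : (\bigcup_(A in M) A) (f y) by rewrite Mcov.
exists A => //; have [m _ hm] := hP A MA.
apply: contrapT => yx; apply: (tP A MA y) Ay => p.
have [k [pk mk] yk] : exists2 k, (p <= k)%N /\ (m <= k)%N &
    ~ exists2 i, (j k <= i < j k.+1)%N &
        y i <> nth false (t A (j (b i))) (i - j (b i)).
  apply: contrapT => nk; apply: yx; exists (maxn p m) => // k /=.
  rewrite geq_max => /andP[pk mk]; apply: contrapT => nyk.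
  by apply: nk; exists k.
exists (j k) => [|l ls]; first exact: leq_trans (jge k).
have lj : (j k <= j k + l < j k.+1)%N.
  have := hm _ (leq_trans mk (jge k)); have := jS k; rewrite /=; lia.
apply: contrapT => nyl; apply: yk; exists (j k + l)%N => //.
by rewrite -(bP _ _ lj) addKn.
Qed.

Lemma meager_covering_points (R : realType) :
  meager_covering (range (fun r : R => [set r])).
Proof.
split=> [_ [r _ <-]|]; last first.
  by apply/seteqP; split=> // r _; exists [set r] => //; exists r.
exists (fun=> [set r]); split=> [_|]; last first.
  by apply/seteqP; split=> [_ ->|_ [_ _ ->]] //; exists 0%N.
rewrite /nowhere_dense -(closure_id _).1; last first.
  exact/accessible_closed_set1/hausdorff_accessible/Rhausdorff.
apply/seteqP; split=> // s sr; have := interior_subset sr => /= sE.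
move: sr; rewrite {}sE => /nbhs_ballP[e /= e0 /(_ (r + e / 2)%R)].
rewrite /ball/= opprD addNKr normrN gtr0_norm; last by rewrite divr_gt0.
by move=> /(_ ltac:(lra)) /=; lra.
Qed.

Lemma weakly_Rothberger_infinitely_often (X : topologicalType)
    (C : nat -> set (set X)) :
  weakly_Rothberger X -> (forall n, open_covering (C n)) ->
  exists U : nat -> set X, (forall n, C n (U n)) /\
    forall p, open [set p] -> forall m, exists2 n, (m <= n)%N & U n p.
Proof.
(* Weak Rothbergerness is applied to each of the infinitely many disjoint
   subsequences (C (c m n))_n. *)
move=> wR Ccov; pose c m n := (2 ^ m * n.*2.+1)%N.
have logc m n : logn 2 (c m n) = m.
  by rewrite lognM // ?expn_gt0 // pfactorK // lognE /= dvdn2 /= odd_double addn0.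
have cinj m n m' n' : c m n = c m' n' -> m = m' /\ n = n'.
  move=> e; have mm' : m = m' by rewrite -(logc m n) e logc.
  split=> //; move/eqP: e; rewrite mm' /c eqn_pmul2l ?expn_gt0 //.
  by rewrite eqSS => /eqP/double_inj.
have mc m n : (m <= c m n)%N.
  by rewrite (leq_trans (ltnW (ltn_expl m (ltnSn 1)))) // leq_pmulr.
have /choice[V VP] m : exists V : nat -> set X,
    (forall n, C (c m n) (V n)) /\ dense (\bigcup_n V n).
  by apply: (wR (fun n => C (c m n))) => n; exact: Ccov.
have [V0 [V0C _]] := wR C Ccov.
have /choice[U UP] k : exists W, C k W /\ forall m n, c m n = k -> W = V m n.
  have [[[m n] /= <-]|nk] := pselect (exists mn, c mn.1 mn.2 = k).
    exists (V m n); split=> [|m' n' /cinj[-> ->] //].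
    exact: (VP m).1.
  by exists (V0 k); split=> // m n e; case: nk; exists (m, n).
exists U; split=> [k|p op m]; first exact: (UP k).1.
have [_ [-> [n _ Vp]]] := (VP m).2 _ (ex_intro _ p erefl) op.
by exists (c m n); rewrite ?((UP _).2 m n erefl).
Qed.

Theorem theorem2p12 (R : realType) :
  card_lt (cov_meager R) bounding_number ->
  exists X : topologicalType,
    [/\ compact [set: X],
        hausdorff_space X,
        ~ weakly_Rothberger X &
        (pi_weight X #= cov_meager R)%card].
Proof.
move=> [_ covb].
have [Mcov _] := @min_cardP _ [set F | @meager_covering R F] _
  (meager_covering_points R).
have M0 : cov_meager R !=set0.
  have : (\bigcup_(A in cov_meager R) A) (0 : R)%R by rewrite Mcov.2.
  by case=> A MA _; exists A.
have [j [x [jlt jx]]] := evading_blocks R _ Mcov covb.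
have [X [q [d [[cX hX] piX od oq dq]]]] := labelled_compactification _ _ x M0.
exists X; split=> // wR.
have [b bP] := block_index j jlt.
pose cyl k z : set X :=
  [set w | forall i, (j k <= i < j k.+1)%N -> d w i = d z i].
have ocyl k z : open (cyl k z).
  rewrite openE => w wz.
  have : nbhs w [set v | forall i : 'I_(j k.+1), d v i = d w i].
    by apply: filter_forall => i; apply: open_nbhs_nbhs; split=> //; exact: od.
  apply: filterS => v vw i /[dup] ki /andP[_ ik].
  by rewrite -wz //; exact: (vw (Ordinal ik)).
have [U [UC Uinf]] : exists U : nat -> set X, (forall k, range (cyl k) (U k)) /\
    forall p, open [set p] -> forall m, exists2 n, (m <= n)%N & U n p.
  apply: (@weakly_Rothberger_infinitely_often X (fun k => range (cyl k))) => // k.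
  split=> [_ [z _ <-] //|]; apply/seteqP; split=> // z _.
  by exists (cyl k z) => //; exists z.
have /choice[z zU] k : exists z, cyl k z = U k by have [z _ <-] := UC k; exists z.
have [A MA [m _ yA]] := jx (fun i => d (z (b i)) i).
have [k mk] := Uinf _ (oq A MA) m.
rewrite -zU /cyl /= dq // => xz; have [i ki] := yA k mk.
by rewrite xz // -(bP i k ki).
Qed.
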